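(* Let $\lambda,\mu$ be partitions with $\mu\subseteq\lambda$. Then \[ c_{\lambda,\mu}(\boldsymbol\alpha,\boldsymbol\beta)=\sum_{T\in\mathrm{ET}_{\mathbb Z}(\lambda/\mu)}\ \prod_{(i,j)\in\lambda/\mu}\big(-\alpha_{T(i,j)+c(i,j)}+\beta_{T(i,j)}\big), \] where $\alpha_m=\beta_m=0$ for $m\le0$. In particular, $g_\lambda(\mathbf x;-\boldsymbol\alpha,\boldsymbol\beta)$ is Schur-positive, that is, $c_{\lambda,\mu}(-\boldsymbol\alpha,\boldsymbol\beta)$ is a polynomial in $\boldsymbol\alpha,\boldsymbol\beta$ with nonnegative integer coefficients.
   Context: Parameters $\boldsymbol\alpha=(\alpha_1,\alpha_2,\dots)$, $\boldsymbol\beta=(\beta_1,\dots)$; $-\boldsymbol\alpha=(-\alpha_1,-\alpha_2,\dots)$. $A_k=\alpha_1+\dots+\alpha_k$, $B_k=\beta_1+\dots+\beta_k$ for $k\ge1$, $A_k=B_k=0$ for $k\le0$. For a formal $\mathbb Z$-linear combination $Z=\sum_uc_uu$ of variables/parameters, $\sum_{m\ge0}h_m[Z]t^m=\prod_u(1-ut)^{-c_u}$ and $h_m[Z]=0$ for $m<0$. For partitions $\lambda,\mu$ with at most $n$ parts, $c_{\lambda,\mu}(\boldsymbol\alpha,\boldsymbol\beta)=\det\big(h_{\lambda_i-\mu_j-i+j}[-A_{\lambda_i-1}+B_{i-1}]\big)_{i,j=1}^n$ (independent of $n\ge\max(\ell(\lambda),\ell(\mu))$); these are the coefficients in the Schur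 expansion $g_\lambda(\mathbf x;\boldsymbol\alpha,\boldsymbol\beta)=\sum_{\mu\subseteq\lambda}c_{\lambda,\mu}(\boldsymbol\alpha,\boldsymbol\beta)s_\mu(\mathbf x)$, where $g_\lambda(\mathbf x;\boldsymbol\alpha,\boldsymbol\beta)$ is the formal power series whose restriction to $x_1,\dots,x_n$ is $\det(h_{\lambda_i+n-i}[x_j-A_{\lambda_i-1}+B_{i-1}])_{i,j=1}^n/\prod_{i<j}(x_i-x_j)$ for every $n\ge\ell(\lambda)$. ''Schur-positive'' means all Schur coefficients are polynomials with nonnegative integer coefficients. Cells of $\lambda/\mu$ are $(i,j)$ with $\mu_i<j\le\lambda_i$; content $c(i,j)=j-i$. A $\mathbb Z$-elegant tableau of shape $\lambda/\mu$ is a filling $T$ of the cells with integers such that rows are weakly increasing, columns strictly increasing, and $\min(i-j,0)<T(i,j)<i$ for all cells (equivalently $\min(i-\mu_i,1)\le T(i,j)<i$). $\mathrm{ET}_{\mathbb Z}(\lambda/\mu)$ is the set of these. *)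

(* Defs.v *)
From Stdlib Require Import ClassicalEpsilon.
From HB Require Import structures.
From mathcomp Require Import all_boot all_order all_algebra finmap monalg.

Set Implicit Arguments.
Unset Strict Implicit.
Unset Printing Implicit Defensive.

Import Order.TTheory GRing.Theory Num.Theory.
Local Open Scope ring_scope.

(* Sequences of parameters are functions a : nat -> R with
   a i standing for a_i, i >= 1; the value a 0 is never used. Rows, columns and
   partition entries stored in sequences or ordinals are 0-based: nth 0 lam i
   is lambda_(i+1). *)

Definition is_partition (s : seq nat) : bool := sorted geq s && (0%N \notin s).

Record intpart := Partition { parts :> seq nat; _ : is_partition parts }.

HB.instance Definition _ := [isSub for parts].
HB.instance Definition _ := [Choice of intpart by <:].

Definition part (lam : intpart) (i : nat) : nat := nth 0%N lam i.

Definition part_sub (mu lam : intpart) : Prop :=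
  forall i, (part mu i <= part lam i)%N.

(* A formal Z-linear combination of elements u of R is Z : {malg int[R]}, with
   coefficients Z@_u. The generator << u >> is not additive in u: the formal
   combination - << u >> and the generator << - u >> are different. *)

(* The series (1 - u t)^(-c), truncated after degree m when it is infinite. *)
Definition hfactor (R : comNzRingType) (m : nat) (u : R) (c : int) : {poly R} :=
  if 0 <= c then (\poly_(k < m.+1) u ^+ k) ^+ `|c|%N
  else (1 - u *: 'X) ^+ `|c|%N.

(* The truncation in hfactor does not affect the coefficient of t^m. *)
Definition h (R : comNzRingType) (m : int) (Z : {malg int[R]}) : R :=
  match m with
  | Posz k => (\prod_(u <- msupp Z) hfactor k u Z@_u)`_k
  | Negz _ => 0
  end.

(* a_1 + ... + a_k as a formal sum; it is 0 at k = 0, so that A_(lambda_i - 1)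
   is psum a (lambda_i).-1 even when lambda_i = 0. *)
Definition psum (R : comNzRingType) (a : nat -> R) (k : nat) : {malg int[R]} :=
  \sum_(1 <= i < k.+1) << a i >>.

Definition c_coef (R : comNzRingType) (n : nat) (lam mu : intpart)
    (a b : nat -> R) : R :=
  \det (\matrix_(i < n, j < n)
    h ((part lam i)%:Z - (part mu j)%:Z - i%:Z + j%:Z)
      (- psum a (part lam i).-1 + psum b i)).

Definition param : choiceType := (nat + nat)%type.

Definition Zab : comNzRingType := {malg int[{cmonom param}]}.

Definition alpha (i : nat) : Zab := << ucm (inl i : param) >>.
Definition beta (i : nat) : Zab := << ucm (inr i : param) >>.

Definition nonneg_coefs (p : Zab) : Prop := forall m : {cmonom param}, 0 <= p@_m.

(* Symmetric functions over Z[alpha, beta] are represented by the sequence of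
   their restrictions to x_1, ..., x_n, all in the ring Z[alpha, beta][x]. *)
Definition Zabx : comNzRingType := {malg Zab[{cmonom nat}]}.

Definition xvar (i : nat) : Zabx := << ucm i >>.

Definition vandermonde (n : nat) : Zabx :=
  \prod_(i < n) \prod_(j < n | (i < j)%N) (xvar i.+1 - xvar j.+1).

(* The exact quotient p / q, arbitrary when q does not divide p. It is only
   used to divide alternants by the Vandermonde product, which divides them
   and is not a zero divisor. *)
Definition exact_quo (p q : Zabx) : Zabx :=
  epsilon (inhabits (0 : Zabx)) (fun r : Zabx => r * q = p).

(* s_mu(x_1, ..., x_n), for n >= size mu. *)
Definition schur (n : nat) (mu : intpart) : Zabx :=
  exact_quo
    (\det (\matrix_(i < n, j < n) xvar j.+1 ^+ (part mu i + n - i.+1)))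
    (vandermonde n).

(* g_lam(x_1, ..., x_n; a, b), for n >= size lam. *)
Definition g_fun (lam : intpart) (a b : nat -> Zab) (n : nat) : Zabx :=
  exact_quo
    (\det (\matrix_(i < n, j < n)
       h (part lam i + n - i.+1)%N%:Z
         (<< xvar j.+1 >>
          - psum (fun k => (a k)%:MP : Zabx) (part lam i).-1
          + psum (fun k => (b k)%:MP : Zabx) i)))
    (vandermonde n).

(* The finitely supported family d gives the Schur coefficients of the
   symmetric function whose restrictions are f n, n >= N. The restriction of
   s_mu to n < size mu variables is zero. *)
Definition schur_expansion (N : nat) (f : nat -> Zabx)
    (d : {malg Zab[intpart]}) : Prop :=
  forall n, (N <= n)%N ->
    f n = \sum_(mu <- msupp d | (size mu <= n)%N) (d@_mu)%:MP * schur n mu.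

Definition schur_positive (N : nat) (f : nat -> Zabx) : Prop :=
  exists d : {malg Zab[intpart]},
    schur_expansion N f d /\ forall mu, nonneg_coefs d@_mu.

(* Cells of lam/mu as 0-based pairs; row and col give the 1-based coordinates. *)
Definition cell (lam mu : intpart) : finType :=
  {u : 'I_(size lam) * 'I_(head 0%N lam) | part mu u.1 <= u.2 < part lam u.1}%N.

Definition row_of (lam mu : intpart) (u : cell lam mu) : nat := (val u).1.+1.
Definition col_of (lam mu : intpart) (u : cell lam mu) : nat := (val u).2.+1.

Definition content (lam mu : intpart) (u : cell lam mu) : int :=
  (col_of u)%:Z - (row_of u)%:Z.

Definition filling (lam mu : intpart) : choiceType := {ffun cell lam mu -> int}.

Definition is_elegant (lam mu : intpart) (T : filling lam mu) : bool :=
  [&& [forall u, forall v,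
        (row_of u == row_of v) && (col_of u <= col_of v)%N ==> (T u <= T v)],
      [forall u, forall v,
        (col_of u == col_of v) && (row_of u < row_of v)%N ==> (T u < T v)]
    & [forall u, (Num.min ((row_of u)%:Z - (col_of u)%:Z) 0 < T u)
                 && (T u < (row_of u)%:Z)]].

(* Entries of an elegant tableau lie in [- lam_1, size lam), which makes the
   set finite; ET_Z_P shows that the window loses nothing. *)
Definition window_filling (lam mu : intpart)
    (w : {ffun cell lam mu -> 'I_(head 0%N lam + size lam)}) : filling lam mu :=
  [ffun u => (w u)%:Z - (head 0%N lam)%:Z].

Definition ET_Z (lam mu : intpart) : {fset filling lam mu} :=
  [fset T in [seq window_filling w
               | w : {ffun cell lam mu -> 'I_(head 0%N lam + size lam)}]
   | is_elegant T]%fset.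

Lemma ET_Z_P (lam mu : intpart) (T : filling lam mu) :
  (T \in ET_Z lam mu) = is_elegant T.
Proof.
rewrite !inE /=; case: (boolP (is_elegant T)) => [elT|]; last by rewrite andbF.
rewrite andbT; move: elT => /and3P[_ _ /forallP bT].
have lo u : 0 <= T u + (head 0%N lam)%:Z.
  have /andP[/ltW le1 _] := bT u; rewrite -lerBlDr sub0r; apply: le_trans le1.
  rewrite le_min oppr_le0 lez_nat leq0n andbT lerBrDr addrC.
  by apply: (@le_trans _ _ 0); rewrite ?subr_le0 ?lez_nat //; apply: ltn_ord.
have ltw u : (`|(T u + (head 0%N lam)%:Z)%R| < head 0%N lam + size lam)%N.
  rewrite -ltz_nat gez0_abs ?lo // PoszD addrC ltrD2l.
  have /andP[_ lt1] := bT u; apply: lt_le_trans lt1 _.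
  by rewrite lez_nat; apply: ltn_ord.
apply/mapP; exists [ffun u => Ordinal (ltw u)]; first by rewrite mem_enum.
by apply/ffunP => u; rewrite !ffunE /= gez0_abs ?addrK ?lo.
Qed.

(* Extension of the parameters to integer indices, by 0 at m <= 0. *)
Definition zext (R : comNzRingType) (a : nat -> R) (m : int) : R :=
  match m with Posz k.+1 => a k.+1 | _ => 0 end.

Definition ET_weight (lam mu : intpart) (a b : nat -> Zab)
    (T : filling lam mu) : Zab :=
  \prod_(u : cell lam mu) (- zext a (T u + content u) + zext b (T u)).

(* Main.v *)
(* Put H(m; p, q) = h_m[B_p - A_q] for integers p, q, with A, B, alpha and beta zero
   at nonpositive indices. Then
     H(m; p, q) = H(m; p - 1, q - 1) + (beta_p - alpha_q) H(m - 1; p, q - 1).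
   Bound the entries of row i by a flag p_i; the determinant of the entries
   H(lambda_i - mu_j - i + j; p_i, lambda_i - i + p_i) is c_(lambda, mu) for
   p_i = i - 1. If (i, lambda_i) is a corner, the recurrence in row i reads
     D(lambda, p) = D(lambda, p - e_i)
                    + (beta_(p_i) - alpha_(p_i + lambda_i - i)) D(lambda - e_i, p),
   and it sorts the flagged tableaux by whether the corner entry equals p_i. If
   lambda_i = lambda_(i+1) and p_i = p_(i+1), the second determinant has two equal
   rows, and p_i can be lowered in the tableaux by column strictness. Acting on the
   first row with the largest flag keeps the flags weakly increasing. The lower
   bound on the entries of an elegant tableau is automatic, since
   beta_T - alpha_(T + c) = 0 when T <= min(0, - c).

   For the Schur expansion, expand h_m[x + Z] in powers of x and apply the
   Cauchy-Binet formula. *)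
Require Import Defs.
From Stdlib Require Import ClassicalEpsilon.
From mathcomp Require Import all_boot all_order all_fingroup all_algebra.
From mathcomp Require Import finmap monalg zify ring.
Set Implicit Arguments.
Unset Strict Implicit.
Unset Printing Implicit Defensive.
Import Order.TTheory GRing.Theory Num.Theory.
Local Open Scope ring_scope.

(** * Complete homogeneous functions of formal sums *)

Section CompleteFunctions.
Variable R : comNzRingType.
Implicit Types (p q : {poly R}) (u : R) (Z : {malg int[R]}).

(** Congruence modulo ['X^n]: the truncated geometric series of [hfactor] inverts [1 - u *: 'X] only
    up to this relation. *)
Definition eqmodX n p q := forall i, (i < n)%N -> p`_i = q`_i.

Lemma eqmodXM n p p' q q' :
  eqmodX n p p' -> eqmodX n q q' -> eqmodX n (p * q) (p' * q').
Proof.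
move=> ep eq i ltin; rewrite !coefM; apply: eq_bigr => j _.
by rewrite ep ?eq //; have := ltn_ord j; lia.
Qed.

Lemma eqmodX_exp n p p' k : eqmodX n p p' -> eqmodX n (p ^+ k) (p' ^+ k).
Proof.
by move=> ep; elim: k => // k IHk; rewrite !exprS; apply: eqmodXM.
Qed.

Lemma eqmodX_prod n (U : seq R) (F G : R -> {poly R}) :
  (forall u, eqmodX n (F u) (G u)) ->
  eqmodX n (\prod_(u <- U) F u) (\prod_(u <- U) G u).
Proof.
move=> eFG; elim: U => [|u U IHU]; first by rewrite !big_nil.
by rewrite !big_cons; apply: eqmodXM.
Qed.

Lemma geometric_eqmodX n u :
  eqmodX n.+1 ((\poly_(k < n.+1) u ^+ k) * (1 - u *: 'X)) 1.
Proof.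
move=> i ltin; rewrite mulrBr mulr1 -scalerAr coefB coefZ coefMX !coef_poly ltin.
case: i ltin => [|i] ltin; rewrite coef1 /= ?mulr0 ?subr0 ?expr0 //.
by rewrite ltnW // -exprS subrr.
Qed.

Lemma hfactorS n u (c : int) :
  eqmodX n.+1 (hfactor n u (c + 1) * (1 - u *: 'X)) (hfactor n u c).
Proof.
have [c_ge0 | c_lt0] := leP 0 c.
  rewrite /hfactor c_ge0 addr_ge0 //.
  have -> : absz (c + 1) = (absz c).+1 by lia.
  rewrite exprSr -mulrA -[X in eqmodX _ _ X]mulr1.
  by apply: eqmodXM => //; apply: geometric_eqmodX.
rewrite [hfactor n u c]/hfactor leNgt c_lt0 /=.
have -> : absz c = (absz (c + 1)).+1 by lia.
rewrite exprSr; apply: eqmodXM => //.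
(* For [c = -1] the exponent 0 falls into the other branch of [hfactor]; either branch is then a
   power with exponent 0. *)
have [c1_lt0 | c1_ge0] := ltP (c + 1) 0; rewrite /hfactor leNgt.
  by rewrite c1_lt0.
have -> : c + 1 = 0 by lia.
by rewrite ltxx.
Qed.

Lemma hfactor_trunc m n u c :
  (m <= n)%N -> eqmodX m.+1 (hfactor n u c) (hfactor m u c).
Proof.
move=> le_mn; rewrite /hfactor; case: ifP => // _; apply: eqmodX_exp => i ltim.
by rewrite !coef_poly ltim (leq_trans ltim).
Qed.

(** A common index set and a common truncation make different formal sums and degrees comparable;
    the added factors have exponent 0. *)
Lemma h_wide (U : {fset R}) (k n : nat) Z :
  (msupp Z `<=` U)%fset -> (k <= n)%N ->
  h k Z = (\prod_(u <- U) hfactor n u Z@_u)`_k.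
Proof.
move=> sZU le_kn; rewrite /h (big_fset_incl _ sZU) => [|u _ Zu].
  by apply/esym/(@eqmodX_prod k.+1) => // u; apply: hfactor_trunc.
by rewrite mcoeff_outdom // /hfactor lexx expr0.
Qed.

Lemma h_neg (m : int) Z : m < 0 -> h m Z = 0.
Proof. by case: m. Qed.

Lemma h0 (m : int) : h m (0 : {malg int[R]}) = (m == 0)%:R.
Proof.
case: m => // k; rewrite (@h_wide fset0 k k) ?msupp0 //.
by rewrite big_seq_fset0 coef1.
Qed.

(** Coefficient of t^m in H_(Z + u)(t) (1 - u t) = H_Z(t), where H_Z is the generating series of the
    [h m Z]. *)
Lemma hD1 (m : int) Z u :
  h m (Z + << u >>) = h m Z + u * h (m - 1) (Z + << u >>).
Proof.
have [m_lt0 | ] := ltP m 0; first by rewrite !h_neg ?mulr0 ?addr0 //; lia.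
case: m => // k _.
pose U := (msupp Z `|` [fset u])%fset.
have sZ : (msupp Z `<=` U)%fset by apply: fsubsetUl.
have sZu : (msupp (Z + << u >>) `<=` U)%fset.
  by apply: fsubset_trans (msuppD_le _ _) (fsetUS _ msuppU_le).
pose P := \prod_(v <- U) hfactor k v (Z + << u >>)@_v.
suff: eqmodX k.+1 (P * (1 - u *: 'X)) (\prod_(v <- U) hfactor k v Z@_v).
  move/(_ k (ltnSn k)); rewrite -(h_wide sZ (leqnn k)) => <-.
  rewrite mulrBr mulr1 coefB -scalerAr coefZ coefMX.
  rewrite (h_wide sZu (leqnn k)) -/P.
  case: k @P => [|k] P; first by rewrite /= !mulr0 subr0 addr0.
  rewrite (_ : k.+1%:Z - 1 = k) ?(h_wide sZu (leqnSn k)) ?subrK //=; lia.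
have Uu : u \in U by rewrite !inE eqxx orbT.
rewrite /P !(big_fsetD1 u Uu) /= mulrAC; apply: eqmodXM.
  by rewrite mcoeffD mcoeffUU; apply: hfactorS.
move=> i _; congr ((polyseq _)`_i); apply: eq_big_seq => v.
by rewrite !inE => /andP[nuv _]; rewrite mcoeffD mcoeffU eq_sym (negPf nuv) addr0.
Qed.

Lemma hB1 (m : int) Z u : h m (Z - << u >>) = h m Z - u * h (m - 1) Z.
Proof. by rewrite -{2 3}(subrK << u >> Z) (hD1 m) addrK. Qed.

Lemma hD1_sum (n : nat) Z u :
  h n (Z + << u >>) = \sum_(k < n.+1) u ^+ k * h (n%:Z - k%:Z) Z.
Proof.
elim: n => [|n IHn]; rewrite hD1 big_ord_recl expr0 mul1r subr0.
  by rewrite big_ord0 /= mulr0.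
rewrite (_ : n.+1%:Z - 1 = n) ?IHn; last lia.
rewrite mulr_sumr; congr (_ + _); apply: eq_bigr => k _.
by rewrite !lift0 mulrA -exprS; congr (_ * h _ _); lia.
Qed.

End CompleteFunctions.

(** * Flagged determinants *)

Section ParameterSums.
Variable R : comNzRingType.
Implicit Types (a b : nat -> R) (Z : {malg int[R]}).

Lemma psum0 a : psum a 0 = 0.
Proof. by rewrite /psum big_geq. Qed.

Lemma psumS a k : psum a k.+1 = psum a k + << a k.+1 >>.
Proof. by rewrite /psum big_nat_recr. Qed.

(** Integer indices let the recurrences hold without boundary cases. *)
Definition zpsum a (k : int) : {malg int[R]} :=
  if k is Posz n then psum a n else 0.

Lemma zpsum_le0 a (k : int) : k <= 0 -> zpsum a k = 0.
Proof. by case: k => [[|k]|k] //= _; apply: psum0. Qed.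

Lemma zext_le0 a (k : int) : k <= 0 -> zext a k = 0.
Proof. by case: k => [[|k]|k]. Qed.

Lemma hD_zpsum (m k : int) Z b :
  h m (Z + zpsum b k)
  = h m (Z + zpsum b (k - 1)) + zext b k * h (m - 1) (Z + zpsum b k).
Proof.
have [k_le0 | k_gt0] := leP k 0.
  by rewrite zext_le0 // !zpsum_le0 ?mul0r ?addr0 //; lia.
have [n ->] : exists n : nat, k = n.+1 by exists (absz k).-1; lia.
rewrite (_ : n.+1%:Z - 1 = n); last lia.
by rewrite /= psumS addrA; apply: hD1.
Qed.

Lemma hB_zpsum (m k : int) Z a :
  h m (Z - zpsum a k)
  = h m (Z - zpsum a (k - 1)) - zext a k * h (m - 1) (Z - zpsum a (k - 1)).
Proof.
have [k_le0 | k_gt0] := leP k 0.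
  by rewrite zext_le0 // !zpsum_le0 ?mul0r ?subr0 //; lia.
have [n ->] : exists n : nat, k = n.+1 by exists (absz k).-1; lia.
rewrite (_ : n.+1%:Z - 1 = n); last lia.
by rewrite /= psumS opprD addrA; apply: hB1.
Qed.

Definition hAB a b (m p q : int) : R := h m (- zpsum a q + zpsum b p).

(** Split off alpha_q, then beta_p from the first term; both leftover terms carry the same factor
    h_(m-1)[B_p - A_(q-1)]. *)
Lemma hAB_rec a b (m p q : int) :
  hAB a b m p q
  = hAB a b m (p - 1) (q - 1)
    + (- zext a q + zext b p) * hAB a b (m - 1) p (q - 1).
Proof.
rewrite /hAB addrC hB_zpsum ![zpsum b p - _]addrC.
by rewrite hD_zpsum; ring.
Qed.

Lemma hAB_le0 a b (m p q : int) :
  p <= 0 -> q <= 0 -> hAB a b m p q = (m == 0)%:R.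
Proof. by move=> p0 q0; rewrite /hAB !zpsum_le0 // oppr0 add0r h0. Qed.

Lemma hAB_neg a b (m p q : int) : m < 0 -> hAB a b m p q = 0.
Proof. exact: h_neg. Qed.

End ParameterSums.

(** * Change of the coefficient ring *)

Section HMorphism.
Variables (R S : comNzRingType) (f : {rmorphism R -> S}).

(** Since [f] may identify distinct generators, supports are not transported; instead the parameters
    are peeled off one by one, by identities valid in both rings. *)
Lemma rmorph_h_psum (a b : nat -> R) (m : int) p q :
  f (h m (- psum a p + psum b q)) = h m (- psum (f \o a) p + psum (f \o b) q).
Proof.
elim: q m => [|q IHq] m; last first.
  rewrite !psumS !addrA /=.
  case: m => [m|m]; last by rewrite /= rmorph0.
  rewrite !hD1_sum rmorph_sum; apply: eq_bigr => k _.
  by rewrite rmorphM rmorphXn /= IHq.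
rewrite !psum0 !addr0; elim: p m => [|p IHp] m.
  by rewrite !psum0 !oppr0 !h0 rmorph_nat.
by rewrite !psumS !opprD !hB1 rmorphB rmorphM !IHp.
Qed.

End HMorphism.

(** The zero block has n - i rows and i + 1 columns, n + 1 in total, so by the pigeonhole principle
    every permutation meets it. *)
Lemma det_zero_block (R : comNzRingType) n (A : 'M[R]_n) (i : 'I_n) :
  (forall k j : 'I_n, (i <= k)%N -> (j <= i)%N -> A k j = 0) -> \det A = 0.
Proof.
move=> A0; apply: big1 => s _.
have [k /andP[lik lski]] : exists k : 'I_n, (i <= k)%N && (s k <= i)%N.
  apply/existsP; apply: contraT => /existsPn no_k.
  pose U := [set k : 'I_n | (i <= k)%N].
  have sub : s @: U \subset U :\ i.
    apply/subsetP => _ /imsetP[k Uk ->]; have := no_k k.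
    rewrite !inE in Uk *; rewrite Uk /= -ltnNge => lt_isk.
    by rewrite (ltnW lt_isk) andbT -val_eqE /= neq_ltn lt_isk orbT.
  have := subset_leq_card sub.
  by rewrite card_imset ?[#|U|](cardsD1 i) ?inE ?leqnn ?ltnn //; apply: perm_inj.
by rewrite (bigD1 k) //= A0 // mul0r mulr0.
Qed.

Section FlaggedDeterminant.
Variables (R : comNzRingType) (a b : nat -> R) (n L : nat) (mu : nat -> nat).
Hypothesis mu_noninc : {homo mu : i j / (i <= j)%N >-> (j <= i)%N}.

Definition upd (T : Type) (f : nat -> T) (i : nat) (x : T) : nat -> T :=
  fun k => if k == i then x else f k.

(** The shifted part mu_j - j in 1-based indexing; it does not refer to the parameters beta. *)
Definition beta_index (j : nat) : int := (mu j)%:Z - j.+1%:Z.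

(* l stands for lambda_i - i, and p - L for the largest entry allowed in row i. *)
Definition flag_entry (l : int) (p j : nat) : R :=
  hAB a b (l - beta_index j) (p%:Z - L%:Z) (l + p%:Z - L%:Z).

Definition flag_det (l : nat -> int) (p : nat -> nat) : R :=
  \det (\matrix_(i < n, j < n) flag_entry (l i) (p i) j).

Lemma eq_flag_det l l' p p' :
  (forall i, (i < n)%N -> l i = l' i) -> (forall i, (i < n)%N -> p i = p' i) ->
  flag_det l p = flag_det l' p'.
Proof.
by move=> el ep; congr (\det _); apply/matrixP => i j; rewrite !mxE el ?ep.
Qed.

(** Multilinearity in row i together with [hAB_rec]: lowering the flag lowers both p and q, while
    removing a box lowers m and q and keeps p. *)
Lemma flag_det_rec l p i : (i < n)%N -> (0 < p i)%N ->
  flag_det l p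
  = flag_det l (upd p i (p i).-1)
    + (- zext a ((p i)%:Z - L%:Z + l i) + zext b ((p i)%:Z - L%:Z))
      * flag_det (upd l i (l i - 1)) p.
Proof.
move=> ltin p_gt0; rewrite -[X in X + _]mul1r.
apply: (@determinant_multilinear _ _ _ _ _ (Ordinal ltin)).
- apply/rowP => j; rewrite !mxE mul1r /upd /= eqxx /flag_entry hAB_rec.
  congr (hAB _ _ _ _ _ + (- zext _ _ + _) * hAB _ _ _ _ _); lia.
- apply/matrixP => k j; rewrite !mxE /upd /=.
  by rewrite eq_sym (negPf (neq_bump _ _)).
- apply/matrixP => k j; rewrite !mxE /upd /=.
  by rewrite eq_sym (negPf (neq_bump _ _)).
Qed.

(** [beta_index] is decreasing, so the rows from i on have entries of negative degree in all columns
    up to i. *)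
Lemma flag_det_block0 l p i : (i < n)%N ->
  (forall k, (i <= k < n)%N -> l k < beta_index i) -> flag_det l p = 0.
Proof.
move=> ltin lt_l; apply: (@det_zero_block _ _ _ (Ordinal ltin)) => k j /= ik ji.
rewrite mxE; apply: hAB_neg.
have := lt_l k; rewrite ik ltn_ord => /(_ isT); have := mu_noninc ji.
rewrite /beta_index; lia.
Qed.

Lemma flag_det_repeat l p i : (i.+1 < n)%N ->
  l i = l i.+1 -> p i = p i.+1 -> flag_det l p = 0.
Proof.
move=> ltin el ep; have lt'in := ltnW ltin.
apply: (@determinant_alternate _ _ _ (Ordinal lt'in) (Ordinal ltin)).
  by rewrite -val_eqE /= neq_ltn leqnn.
by move=> j; rewrite !mxE /= el ep.
Qed.

(** The shift by L makes both indices p and q nonpositive, so each entry is 1 in degree 0 and 0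
    otherwise; above the diagonal the degree is positive. *)
Lemma flag_det_base (lam : nat -> nat) :
  (forall i, (i < n)%N -> (mu i <= lam i <= L)%N) ->
  flag_det (fun i => (lam i)%:Z - i.+1%:Z) (fun=> 0%N)
  = (\prod_(i < n) (lam i == mu i))%N%:R.
Proof.
move=> lamP; rewrite /flag_det det_trig; last first.
  apply/is_trig_mxP => i j lt_ij; rewrite mxE /flag_entry hAB_le0; first last.
  - have := lamP i (ltn_ord i); lia.
  - lia.
  rewrite (_ : _ == 0 = false) //; apply/negbTE.
  have := lamP j (ltn_ord j); have := lamP i (ltn_ord i); rewrite /beta_index.
  have := mu_noninc (ltnW lt_ij).
  lia.
rewrite natr_prod; apply: eq_bigr => i _; rewrite mxE /flag_entry hAB_le0; first last.
- have := lamP i (ltn_ord i); lia.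
- lia.
congr (_%:R); congr nat_of_bool; rewrite /beta_index; lia.
Qed.

End FlaggedDeterminant.

(** * Flagged fillings *)

Lemma part_noninc (lam : intpart) : {homo part lam : i j / (i <= j)%N >-> (j <= i)%N}.
Proof.
case: lam => s sP i j lij; rewrite /part /=; have /andP[s_sorted _] := sP.
have [ltj | gej] := ltnP j (size s); last by rewrite nth_default.
apply: (@sorted_leq_nth _ geq _ _ 0%N s s_sorted i j) => //.
- by move=> x y z /= yx zy; apply: leq_trans zy yx.
- by move=> x /=.
- by rewrite inE; apply: leq_ltn_trans lij ltj.
Qed.

Lemma part_head (lam : intpart) i : (part lam i <= head 0 lam)%N.
Proof. by rewrite -nth0; apply: (@part_noninc lam 0 i). Qed.

Lemma part_gt0E (lam : intpart) i : (0 < part lam i)%N = (i < size lam)%N.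
Proof.
have [lti | gei] := ltnP i (size lam); last by rewrite /part nth_default.
case: lam lti => s sP lti; rewrite /part /= lt0n; have /andP[_ s0] := sP.
by apply: contraNneq s0 => <-; apply: mem_nth.
Qed.

Section Fillings.
Variables (R : comNzRingType) (a b : nat -> R) (lam0 mu : intpart).
Local Notation X := (cell lam0 mu).
Local Notation L := (head 0%N lam0).
Variable K : nat.
(* The value t of a filling stands for the tableau entry t - L. *)
Local Notation fill := {ffun X -> 'I_K}.
Implicit Types (u v : X) (lam p : nat -> nat) (T : fill).

(* 0-based, unlike row_of and col_of. *)
Definition row0 u : nat := (val u).1.
Definition col0 u : nat := (val u).2.

Lemma cellP u : (part mu (row0 u) <= col0 u < part lam0 (row0 u))%N.
Proof. exact: valP u. Qed.

Lemma cell_inj u v : row0 u = row0 v -> col0 u = col0 v -> u = v.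
Proof.
case: u v => [[i j] uP] [[i' j'] vP] /= er ec; apply: val_inj => /=.
by congr (_, _); apply: val_inj.
Qed.

Lemma cell_exists i j :
  (part mu i <= j < part lam0 i)%N -> {u : X | row0 u = i & col0 u = j}.
Proof.
move=> ijP; have lti : (i < size lam0)%N by rewrite -part_gt0E; lia.
have ltj : (j < L)%N by have := part_head lam0 i; lia.
by exists (exist _ (Ordinal lti, Ordinal ltj) ijP).
Qed.

Definition in_shape lam u := (col0 u < lam (row0 u))%N.

Definition entry_weight (t : nat) u : R :=
  - zext a (t%:Z - L%:Z + content u) + zext b (t%:Z - L%:Z).

(* Cells outside lam carry 0, which lets all shapes share the cells of lam0/mu. *)
Definition flagged lam p T : bool :=
  [forall u, if in_shape lam u then (T u <= p (row0 u))%N else T u == 0%N :> nat]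
  && [forall u, forall v, in_shape lam u && in_shape lam v ==>
       ((row0 u == row0 v) && (col0 u <= col0 v)%N ==> (T u <= T v)%N)
       && ((col0 u == col0 v) && (row0 u < row0 v)%N ==> (T u < T v)%N)].

Lemma flaggedP lam p T : reflect
  [/\ forall u, in_shape lam u -> (T u <= p (row0 u))%N,
      forall u, ~~ in_shape lam u -> T u = 0%N :> nat,
      forall u v, in_shape lam u -> in_shape lam v -> row0 u = row0 v ->
        (col0 u <= col0 v)%N -> (T u <= T v)%N
    & forall u v, in_shape lam u -> in_shape lam v -> col0 u = col0 v ->
        (row0 u < row0 v)%N -> (T u < T v)%N]
  (flagged lam p T).
Proof.
apply: (iffP andP) => [[/forallP flagT /forallP ordT]|[fT oT rT cT]].
  split=> [u uin|u uout|u v uin vin e l|u v uin vin e l].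
  - by have := flagT u; rewrite uin.
  - by have := flagT u; rewrite (negPf uout) => /eqP.
  - by have /forallP/(_ v) := ordT u; rewrite uin vin e eqxx l => /andP[].
  - by have /forallP/(_ v) := ordT u; rewrite uin vin e eqxx l => /andP[].
split; first by apply/forallP => u; case: ifPn => [/fT|/oT/eqP].
apply/forallP => u; apply/forallP => v; apply/implyP => /andP[uin vin].
by apply/andP; split; apply/implyP => /andP[/eqP e l]; [apply: rT|apply: cT].
Qed.

Definition filling_sum lam p : R :=
  \sum_(T : fill | flagged lam p T) \prod_(u | in_shape lam u) entry_weight (T u) u.

(** Serves when no entry of row i attains the flag: the row has no cells, or column strictness
    forbids it. *)
Lemma filling_sum_lower lam p i :
  (forall T u, flagged lam p T -> in_shape lam u -> row0 u = i ->
    (T u <= (p i).-1)%N) ->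
  filling_sum lam p = filling_sum lam (upd p i (p i).-1).
Proof.
move=> leT; apply: eq_bigl => T; apply/idP/idP => flT.
  have /flaggedP[fT oT rT cT] := flT; apply/flaggedP; split=> // u uin.
  rewrite /upd; case: eqP => [ui|_]; last exact: fT.
  by apply: leT.
have /flaggedP[fT oT rT cT] := flT; apply/flaggedP; split=> // u uin.
apply: leq_trans (fT u uin) _; rewrite /upd; case: eqP => // ->; exact: leq_pred.
Qed.

(* The rows above i have smaller flags, so an entry p_i in the corner never breaks
   column strictness. *)
Lemma filling_sum_rec lam p i (u0 : X) :
  {homo lam : i j / (i <= j)%N >-> (j <= i)%N} ->
  row0 u0 = i -> (col0 u0).+1 = lam i -> (lam i.+1 < lam i)%N ->
  (0 < p i < K)%N -> (forall k, (k < i)%N -> (p k < p i)%N) ->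
  filling_sum lam p
  = filling_sum lam (upd p i (p i).-1)
    + entry_weight (p i) u0 * filling_sum (upd lam i (lam i).-1) p.
Proof.
move=> lam_noninc ru0 cu0 corner /andP[p_gt0 p_ltK] p_lt.
have u0in : in_shape lam u0 by rewrite /in_shape ru0 -cu0.
rewrite /filling_sum (bigID (fun T => T u0 == p i :> nat)) /= addrC.
congr (_ + _).
  (* The corner entry is the largest of its row, so it differs from p_i exactly when the whole row
     obeys the lowered flag. *)
  apply: eq_bigl => T; apply/andP/idP => [[/flaggedP[fT oT rT cT] npi]|].
    apply/flaggedP; split=> // u uin; rewrite /upd; case: eqP => [ui|_]; last exact: fT.
    have := fT _ u0in; rewrite ru0; have : (T u <= T u0)%N.
      by apply: rT; rewrite // ?ui ?ru0 //; move: uin; rewrite /in_shape ui; lia.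
    by move: npi => /= /eqP; lia.
  move=> /flaggedP[fT oT rT cT]; split; last first.
    by apply/eqP => e; have := fT _ u0in; rewrite /upd ru0 eqxx e; lia.
  apply/flaggedP; split=> // u uin; apply: leq_trans (fT _ uin) _.
  by rewrite /upd; case: eqP => // ->; apply: leq_pred.
have K_gt0 : (0 < K)%N by lia.
(* Fillings with corner entry p_i correspond to fillings of the smaller shape: [set_u0 pi] writes
   p_i in the corner, [set_u0 z] restores the 0 prescribed outside the shape. *)
pose set_u0 (x : 'I_K) T : fill := [ffun v => if v == u0 then x else T v].
pose pi := Ordinal p_ltK; pose z := Ordinal K_gt0.
rewrite (reindex_onto (set_u0 pi) (set_u0 z)) /=; last first.
  move=> T /andP[_ /eqP Tu0]; apply/ffunP => v; rewrite !ffunE.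
  by case: eqP => // ->; apply/val_inj; rewrite /= Tu0.
have lam'E u : in_shape (upd lam i (lam i).-1) u = in_shape lam u && (u != u0).
  rewrite /in_shape /upd; case: eqP => [ui|nui]; last first.
    by case: eqP => [eu|_]; [case: nui; rewrite eu | rewrite andbT].
  rewrite ui; case: eqP => [->|nu]; first by lia.
  suff: col0 u <> col0 u0 by lia.
  by move=> eqc; apply: nu; apply: cell_inj; rewrite ?ru0.
have outu0 : ~~ in_shape (upd lam i (lam i).-1) u0 by rewrite lam'E eqxx andbF.
rewrite mulr_sumr; apply: eq_big => [T|T /andP[_ /eqP TE]]; last first.
  rewrite (bigD1 u0) //= !ffunE eqxx; congr (_ * _).
  apply: eq_big => [u|u /andP[_ /negPf nu]]; last by rewrite ffunE nu.
  by rewrite lam'E.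
set T' := set_u0 pi T.
have T'E u : u != u0 -> T' u = T u by move=> /negPf nu; rewrite ffunE nu.
have T'u0 : T' u0 = pi by rewrite ffunE eqxx.
rewrite T'u0 eqxx andbT.
apply/andP/flaggedP.
  case=> /flaggedP[fT oT rT cT] /eqP TE.
  split=> [u|u|u v|u v]; rewrite !lam'E.
  - by case/andP=> uin nu; rewrite -T'E // fT.
  - have [->|nu] := eqVneq u u0; first by rewrite -TE ffunE eqxx.
    by rewrite andbT -T'E //; apply: oT.
  - by case/andP=> uin nu /andP[vin nv]; rewrite -!T'E //; apply: rT.
  - by case/andP=> uin nu /andP[vin nv]; rewrite -!T'E //; apply: cT.
case=> fT oT rT cT; split; last first.
  apply/eqP/ffunP => v; rewrite !ffunE; case: eqP => // ->.
  by apply/val_inj; rewrite /= oT.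
apply/flaggedP; split=> [u uin|u uout|u v uin vin e l|u v uin vin e l].
- have [->|nu] := eqVneq u u0; first by rewrite T'u0 ru0.
  by rewrite T'E // fT // lam'E uin.
- have nu : u != u0 by apply: contraNneq uout => ->.
  by rewrite T'E // oT // lam'E (negPf uout).
- have [eu|nu] := eqVneq u u0.
    rewrite -(@cell_inj u v) // eu; move: vin; rewrite /in_shape -e eu ru0.
    by rewrite eu in l; lia.
  have [ev|nv] := eqVneq v u0; last by rewrite !T'E // rT // lam'E ?uin ?vin.
  rewrite ev T'u0 T'E //=; have := fT u; rewrite lam'E uin nu => /(_ isT).
  by rewrite e ev ru0.
(* [lam i.+1 < lam i] excludes a cell of the shape below the corner. *)
- have nu : u != u0.
    apply/eqP => eu; rewrite eu ru0 in e l; move: vin; rewrite /in_shape.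
    have := @lam_noninc i.+1 (row0 v) l; lia.
  have [ev|nv] := eqVneq v u0; last by rewrite !T'E // cT // lam'E ?uin ?vin.
  rewrite ev T'u0 T'E //=; rewrite ev ru0 in l.
  by apply: leq_ltn_trans (p_lt _ l); rewrite fT // lam'E uin.
Qed.

Variable n : nat.
Hypothesis size_le_n : (size lam0 <= n)%N.

(** A cell of the shape would hold 0, that is, the tableau entry -L, and both parameter indices of
    its weight would be nonpositive. So only the empty shape contributes, by the zero filling. *)
Lemma filling_sum_base lam :
  (forall i, (part mu i <= lam i <= part lam0 i)%N) -> (X -> (0 < K)%N) ->
  filling_sum lam (fun=> 0%N)
  = (\prod_(i < n) (lam i == part mu i))%N%:R.
Proof.
move=> lamP K_gt0.
have [/existsP[u uin]|/existsPn none_in] := boolP [exists u, in_shape lam u].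
  have lt_rw : (row0 u < n)%N by apply: leq_trans (ltn_ord _) size_le_n.
  rewrite (bigD1 (Ordinal lt_rw)) //= [lam _ == _](_ : _ = false) ?mul0n; last first.
    by apply/eqP => e; have := cellP u; move: uin; rewrite /in_shape e; lia.
  apply: big1 => T /flaggedP[/(_ u uin) Tu0 _ _ _]; rewrite (bigD1 u) //=.
  rewrite leqn0 in Tu0; rewrite (eqP Tu0) /entry_weight !zext_le0 ?oppr0 ?addr0 ?mul0r //.
    lia.
  have := part_head lam0 (row0 u); have := cellP u.
  by rewrite /content /row_of /col_of -/(row0 u) -/(col0 u); lia.
rewrite big1 => [|i _]; last first.
  apply/eqP; rewrite eqb1; have /andP[le_mu le_lam] := lamP i.
  rewrite eqn_leq le_mu andbT leqNgt; apply/negP => lt_mu.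
  have [|u ru cu] := @cell_exists i (part mu i); first lia.
  by have := none_in u; rewrite /in_shape ru cu lt_mu.
rewrite /filling_sum (big_pred1 [ffun u => Ordinal (K_gt0 u)]) => [|T].
  by rewrite big_pred0 // => u; apply/negbTE.
apply/flaggedP/eqP => [[_ oT _ _]|->].
  by apply/ffunP => u; apply/val_inj; rewrite ffunE /= oT.
by split=> [u|u|u v|u v]; rewrite ?(negPf (none_in u)) // ffunE.
Qed.
End Fillings.

(** * The tableau formula *)

Lemma sum_upd_pred (n : nat) (f : nat -> nat) i : (i < n)%N -> (0 < f i)%N ->
  (\sum_(k < n) upd f i (f i).-1 k).+1 = (\sum_(k < n) f k)%N.
Proof.
move=> ltin fi; rewrite (bigD1 (Ordinal ltin)) // [RHS](bigD1 (Ordinal ltin)) //=.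
rewrite {1}/upd eqxx -addSn prednK //.
congr (_ + _)%N; apply: eq_bigr => k.
by rewrite -val_eqE /upd /= => /negPf ->.
Qed.

Section FlaggedExpansion.
Variables (R : comNzRingType) (a b : nat -> R) (lam0 mu : intpart) (K n : nat).
Hypothesis size_le_n : (size lam0 <= n)%N.
Local Notation L := (head 0%N lam0).
Implicit Types lam p : nat -> nat.

Definition shifted lam (k : nat) : int := (lam k)%:Z - k.+1%:Z.

Lemma eq_filling_sum lam p p' :
  (forall i, (i < size lam0)%N -> p i = p' i) ->
  filling_sum a b lam0 mu K lam p = filling_sum a b lam0 mu K lam p'.
Proof.
move=> ep; apply: eq_bigl => T; rewrite /flagged; congr (_ && _).
by apply: eq_forallb => u; rewrite ep //; apply: ltn_ord.
Qed.

(** Induction on the sum of all parts and flags: both sides obey the same recurrence and agree when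
    all flags are 0. *)
Lemma flag_det_filling_sum lam p :
  {homo lam : i j / (i <= j)%N >-> (j <= i)%N} ->
  (forall i, (part mu i <= lam i <= part lam0 i)%N) ->
  (forall i j, (i <= j < n)%N -> (p i <= p j)%N) ->
  (forall i, (i < size lam0)%N -> (p i < K)%N) ->
  flag_det a b n L (part mu) (shifted lam) p = filling_sum a b lam0 mu K lam p.
Proof.
have [N] := ubnP (\sum_(i < n) lam i + \sum_(i < n) p i)%N.
elim: N lam p => // N IHN lam p ltN lam_noninc lamP p_mono p_ltK.
have [/existsP[i0 p_i0]|/existsPn p0] := boolP [exists i : 'I_n, 0 < p i]%N; last first.
  have {}p0 i : (i < n)%N -> p i = 0%N.
    by move=> ltin; have := p0 (Ordinal ltin); rewrite lt0n negbK => /eqP.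
  have K_gt0 : cell lam0 mu -> (0 < K)%N.
    by move=> u; apply: leq_ltn_trans (p_ltK _ (ltn_ord (val u).1)).
  rewrite (@eq_flag_det _ _ _ _ _ _ _ (shifted lam) _ (fun=> 0%N)) //.
  rewrite (@eq_filling_sum _ _ (fun=> 0%N)) => [|i lti]; last by rewrite p0 ?(leq_trans lti).
  rewrite (filling_sum_base _ _ size_le_n) // flag_det_base //; first exact: part_noninc.
  by move=> i _; have := lamP i; have := part_head lam0 i; lia.
(* The row [i] is the first one with the largest flag, so lowering [p i] keeps the flags weakly
   increasing. *)
pose P k := p k == p n.-1.
have [i /eqP pi min_i] := ex_minnP (ex_intro P n.-1 (eqxx _)).
have lt_i0n := ltn_ord i0.
have le_in : (i <= n.-1)%N by apply: min_i; apply: eqxx.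
have ltin : (i < n)%N by lia.
have p_gt0 : (0 < p i)%N.
  by rewrite pi; apply: leq_trans p_i0 (p_mono _ _ _); lia.
have p_lt k : (k < i)%N -> (p k < p i)%N.
  move=> ltki; rewrite pi ltn_neqAle p_mono ?andbT; last lia.
  by apply: contraL ltki => /min_i; rewrite -leqNgt.
have p_eq k : (i <= k < n)%N -> p k = p i.
  move=> ik; apply/eqP; rewrite eqn_leq (p_mono i k) // andbT pi.
  by apply: p_mono; lia.
have lower : flag_det a b n L (part mu) (shifted lam) (upd p i (p i).-1)
    = filling_sum a b lam0 mu K lam (upd p i (p i).-1).
  apply: IHN => //.
  - by have := sum_upd_pred ltin p_gt0; lia.
  - move=> j k jk; rewrite /upd; have := p_mono j k jk.
    case: eqP => [ej|nj]; case: eqP => [ek|nk]; rewrite ?ej ?ek //; first lia.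
    by have := p_lt j; lia.
  - by move=> j ltj; rewrite /upd; have := p_ltK _ ltj; case: eqP => [->|_]; lia.
rewrite (@flag_det_rec _ _ _ _ _ _ _ _ i) // lower.
have shiftedE : upd (shifted lam) i (shifted lam i - 1) i = (lam i)%:Z - 1 - i.+1%:Z.
  by rewrite /upd eqxx /shifted; lia.
have /andP[le_mu_lam le_lam] := lamP i.
have [lt_mu_lam | ge_mu_lam] := ltnP (part mu i) (lam i); last first.
  (* Row i has no cells: removing a box would leave lam_i - 1 < mu_i, which gives a zero block, and
     the flag of row i constrains no entry. *)
  rewrite (@flag_det_block0 _ _ _ _ _ _ _ _ _ i) ?mulr0 ?addr0 //.
  - rewrite -(@filling_sum_lower _ _ _ _ _ _ _ _ i) // => T u _ uin ui.
    by have := cellP u; move: uin; rewrite /in_shape ui; lia.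
  - exact: part_noninc.
  - move=> k /andP[ik ltkn]; have := lam_noninc _ _ ik.
    by rewrite /upd /shifted /beta_index; case: eqP => [->|nki]; lia.
have lam_next := lam_noninc _ _ (leqnSn i).
have lti : (i < size lam0)%N by rewrite -part_gt0E; lia.
have [corner | flat] := ltnP (lam i.+1) (lam i); last first.
  have ltSin : (i.+1 < n)%N.
    apply: leq_trans _ size_le_n; rewrite -part_gt0E.
    by have := lamP i.+1; lia.
  (* Equal parts and equal flags: after the removal of a box, (lam_i - 1) - i = lam_(i+1) - (i + 1),
     so two rows agree. *)
  rewrite (@flag_det_repeat _ _ _ _ _ _ _ _ i) ?mulr0 ?addr0 //.
  - rewrite -(@filling_sum_lower _ _ _ _ _ _ _ _ i) // => T u flT uin ui.
    have /flaggedP[fT _ rT cT] := flT.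
    (* With [v] the last cell of row i and [w] the cell under it,
       [T u <= T v < T w <= p i.+1 = p i]. *)
    have [|v rv cv] := @cell_exists lam0 mu i (lam i).-1; first lia.
    have [|w rw_w cw] := @cell_exists lam0 mu i.+1 (lam i).-1.
      by have := lamP i.+1; have := part_noninc mu (leqnSn i); lia.
    have vin : in_shape lam v by rewrite /in_shape rv cv; lia.
    have win : in_shape lam w by rewrite /in_shape rw_w cw; lia.
    have le_uv : (T u <= T v)%N.
      by apply: rT; rewrite ?rv // cv; move: uin; rewrite /in_shape ui; lia.
    have lt_vw : (T v < T w)%N by apply: cT; rewrite ?cv ?rv ?rw_w.
    have le_w : (T w <= p i)%N by rewrite -(p_eq i.+1) -?rw_w ?fT // rw_w; lia.
    by lia.
  - by rewrite shiftedE /upd /shifted; case: eqP => [|_]; lia.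
  - by rewrite p_eq //; lia.
have [|u0 ru0 cu0] := @cell_exists lam0 mu i (lam i).-1; first lia.
have cu0S : (col0 u0).+1 = lam i by lia.
have p_bounds : (0 < p i < K)%N by rewrite p_gt0 p_ltK.
rewrite [RHS](@filling_sum_rec _ _ _ _ _ _ _ _ i u0) //.
congr (_ + _ * _).
  rewrite /entry_weight; congr (- zext _ (_ + _) + _).
  by rewrite /content /row_of /col_of -/(row0 u0) -/(col0 u0) ru0 cu0 /shifted; lia.
have lam_gt0 : (0 < lam i)%N by lia.
rewrite -IHN //.
- apply: eq_flag_det => // k _; rewrite /shifted /upd.
  by case: eqP => [->|//]; lia.
- by have := sum_upd_pred ltin lam_gt0; lia.
- move=> j k jk; rewrite /upd; have := lam_noninc j k jk.
  case: eqP => [ek|nk]; case: eqP => [ej|nj]; rewrite ?ej ?ek //; try lia.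
  by have := lam_noninc i.+1 k; lia.
- by move=> j; rewrite /upd; case: eqP => [->|_]; [lia | apply: lamP].
Qed.

End FlaggedExpansion.

(** * From flagged fillings to elegant tableaux *)

Section ElegantTableaux.
Variables (a b : nat -> Zab) (lam mu : intpart).
Local Notation L := (head 0%N lam).
Local Notation K := (head 0%N lam + size lam)%N.
Local Notation fill := {ffun cell lam mu -> 'I_K}.

Lemma window_filling_inj : injective (@window_filling lam mu).
Proof.
move=> w w' /ffunP eqw; apply/ffunP => u; have := eqw u; rewrite !ffunE => e.
by move/addIr: e => [/val_inj].
Qed.

Lemma sum_ET_Z (f : filling lam mu -> Zab) :
  \sum_(T <- ET_Z lam mu) f T
  = \sum_(w : fill | is_elegant (window_filling w)) f (window_filling w).
Proof.
pose s := [seq window_filling w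
            | w : fill <- index_enum _ & is_elegant (window_filling w)].
rewrite (perm_big s) /=; first by rewrite big_map big_filter.
apply: uniq_perm.
- exact: fset_uniq.
- rewrite map_inj_uniq; last exact: window_filling_inj.
  by rewrite filter_uniq ?index_enum_uniq.
move=> T; rewrite ET_Z_P; apply/idP/mapP => [elT|[w]]; last first.
  by rewrite mem_filter => /andP[elw _] ->.
have : T \in ET_Z lam mu by rewrite ET_Z_P.
rewrite !inE /= => /andP[/mapP[w _ ew] _].
by exists w; rewrite ?mem_filter ?mem_index_enum ?andbT -?ew.
Qed.

(** The flag L + i encodes the upper bound on elegant entries. A flagged filling that is not elegant
    breaks only the lower bound, at a cell of weight 0. *)
Lemma filling_sum_ET_Z :
  filling_sum a b lam mu K (part lam) (addn L)
  = \sum_(T <- ET_Z lam mu) ET_weight a b T.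
Proof.
rewrite sum_ET_Z /filling_sum.
have inlam (u : cell lam mu) : in_shape (part lam) u.
  by have := cellP u; rewrite /in_shape => /andP[].
rewrite (bigID (fun w => is_elegant (window_filling w))) /= addrC big1 ?add0r.
  apply: eq_big => [w|w _]; last first.
    by rewrite /ET_weight; apply: eq_big => [u|u _]; rewrite ?inlam // /entry_weight ffunE.
  rewrite andb_idl // => /and3P[/forallP rows /forallP cols /forallP bounds].
  apply/flaggedP; split=> [u _|u|u v _ _ e l|u v _ _ e l].
  - by have /andP[_] := bounds u; rewrite ffunE /row_of -/(row0 u); lia.
  - by rewrite inlam.
  - have /forallP/(_ v) := rows u; rewrite !ffunE /row_of /col_of -/(row0 u) -/(row0 v).
    by rewrite -/(col0 u) -/(col0 v) e eqxx ltnS l /=; lia.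
  - have /forallP/(_ v) := cols u; rewrite !ffunE /row_of /col_of -/(row0 u) -/(row0 v).
    by rewrite -/(col0 u) -/(col0 v) e eqxx ltnS l /=; lia.
move=> w /andP[/flaggedP[fw _ rw_ cw]].
have [/existsP[u]|/existsPn good] := boolP [exists u : cell lam mu,
    window_filling w u <= Num.min ((row_of u)%:Z - (col_of u)%:Z) 0].
  rewrite le_min ffunE => /andP[wu_rc wu_0].
  rewrite (bigD1 u) ?inlam //= /entry_weight !zext_le0 ?oppr0 ?addr0 ?mul0r //.
  by rewrite /content -(opprB (row_of u)%:Z) subr_le0.
case/negP; apply/and3P; split; apply/forallP => u; last first.
- rewrite ltNge good /= ffunE /row_of -/(row0 u).
  by have := fw u (inlam u); lia.
- apply/forallP => v; apply/implyP => /andP[/eqP[e] l]; rewrite !ffunE.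
  by have := cw u v (inlam u) (inlam v) e l; lia.
- apply/forallP => v; apply/implyP => /andP[/eqP[e] l]; rewrite !ffunE.
  by have := rw_ u v (inlam u) (inlam v) e l; lia.
Qed.

End ElegantTableaux.

Lemma c_coef_flag_det (R : comNzRingType) (n : nat) (lam mu : intpart) (a b : nat -> R) :
  c_coef n lam mu a b
  = flag_det a b n (head 0%N lam) (part mu) (shifted (part lam)) (addn (head 0%N lam)).
Proof.
congr (\det _); apply/matrixP => i j; rewrite !mxE /flag_entry /hAB /shifted /beta_index.
rewrite (_ : (head 0%N lam + i)%N%:Z - _ = i); last lia.
rewrite (_ : _ + (head 0%N lam + i)%N%:Z - _ = (part lam i)%:Z - 1); last lia.
rewrite /zpsum; congr (h _ (- _ + _)); first lia.
(* For lambda_i = 0 the truncated predecessor is 0 and the integer one is -1; both partial sums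
   vanish. *)
case: (part lam i) => [|k]; first by rewrite psum0.
by rewrite (_ : k.+1%:Z - 1 = k) //; lia.
Qed.

Lemma c_coef_ET_Z (n : nat) (lam mu : intpart) (a b : nat -> Zab) :
  part_sub mu lam -> (size lam <= n)%N ->
  c_coef n lam mu a b = \sum_(T <- ET_Z lam mu) ET_weight a b T.
Proof.
move=> sub_mu le_n; rewrite c_coef_flag_det.
rewrite (@flag_det_filling_sum _ _ _ _ _ (head 0 lam + size lam)%N) //.
- exact: filling_sum_ET_Z.
- exact: part_noninc.
- by move=> i; rewrite sub_mu leqnn.
- by move=> i j ij; rewrite leq_add2l; case/andP: ij.
- by move=> i lti; rewrite ltn_add2l.
Qed.

(** A row with lambda_i < mu_i creates a zero block; [size mu <= n] places such a row among the
    first n. *)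
Lemma c_coef_not_sub (R : comNzRingType) (n : nat) (lam mu : intpart) (a b : nat -> R) :
  (size mu <= n)%N -> ~ part_sub mu lam -> c_coef n lam mu a b = 0.
Proof.
move=> le_n not_sub.
have [/existsP[i lt_mu]|/existsPn no_lt] := boolP [exists i : 'I_n, part lam i < part mu i]%N.
  rewrite c_coef_flag_det (@flag_det_block0 _ _ _ _ _ _ _ _ _ i) // => [|k /andP[ik _]].
    exact: part_noninc.
  by have := part_noninc lam ik; rewrite /shifted /beta_index; lia.
case: not_sub => i; have [lti|gei] := ltnP i n.
  by rewrite leqNgt; apply: no_lt (Ordinal lti).
by rewrite [part mu i]nth_default // (leq_trans le_n).
Qed.

(** * The Cauchy-Binet formula *)

Section CauchyBinet.
Variables (n N : nat).
Local Notation idx := {ffun 'I_n -> 'I_N}.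

(** Encodes the n-subsets of the summation indices, in decreasing order to match the exponents mu_i
    + n - i. *)
Definition decreasing (g : idx) : bool :=
  [forall i : 'I_n, forall j : 'I_n, (i < j)%N ==> (g j < g i)%N].

Lemma decreasingP (g : idx) :
  reflect (forall i j : 'I_n, (i < j)%N -> (g j < g i)%N) (decreasing g).
Proof.
apply: (iffP forallP) => [dg i j lt_ij | dg i].
  by have /forallP/(_ j)/implyP := dg i; apply.
by apply/forallP => j; apply/implyP; apply: dg.
Qed.

Let gtI : rel 'I_N := fun x y => (y < x)%N.
Let values (g : idx) := [tuple g i | i < n].

Let decreasing_sorted (g : idx) : decreasing g -> sorted gtI (values g).
Proof.
move=> /decreasingP dg; rewrite /= sorted_map.
apply: (@sub_sorted _ (relpre val ltn)) => [i j /dg //|].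
by rewrite -sorted_map val_enum_ord iota_ltn_sorted.
Qed.

Lemma decreasing_inj (g : idx) : decreasing g -> injective g.
Proof.
move=> /decreasingP dg i j eg.
by case: (ltngtP i j) => [/dg|/dg|/val_inj //]; rewrite eg ltnn.
Qed.

(** The set of values determines its decreasing enumeration [g]; injectivity of [g] then determines
    [s]. *)
Lemma decreasing_perm_inj (g g' : idx) (s s' : 'S_n) :
  decreasing g -> decreasing g' ->
  [ffun i => g (s i)] = [ffun i => g' (s' i)] -> g = g' /\ s = s'.
Proof.
move=> dg dg' /ffunP eqgs.
have eqg : g = g'.
  have img : values g =i values g'.
    move=> x; apply/mapP/mapP => [[i _ ->]|[i _ ->]].
      exists (s' (s^-1 i)%g); first exact: mem_enum.
      by have := eqgs (s^-1 i)%g; rewrite !ffunE permKV.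
    exists (s (s'^-1 i)%g); first exact: mem_enum.
    by have := eqgs (s'^-1 i)%g; rewrite !ffunE permKV.
  have eqv : values g = values g'.
    apply: val_inj; apply: (@irr_sorted_eq _ gtI) => //.
    - by move=> x y z; rewrite /gtI => yx zy; apply: ltn_trans zy yx.
    - by move=> x; rewrite /gtI ltnn.
    - exact: decreasing_sorted.
    - exact: decreasing_sorted.
  by apply/ffunP => i; have := congr1 (fun t => tnth t i) eqv; rewrite !tnth_mktuple.
split=> //; apply/permP => i; apply: (decreasing_inj dg).
by have := eqgs i; rewrite !ffunE eqg.
Qed.

Lemma inj_decreasing_perm (f : idx) : injective f ->
  exists g (s : 'S_n), decreasing g /\ f = [ffun i => g (s i)].
Proof.
move=> f_inj.
pose leI : rel 'I_N := fun x y => (y <= x)%N.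
have leI_total : total leI by move=> x y; rewrite /leI; apply: leq_total.
have leI_tr : transitive leI by move=> x y z yx zy; apply: leq_trans zy yx.
have size_t : size (sort leI (values f)) == n by rewrite size_sort size_tuple.
pose t := Tuple size_t.
have /tuple_permP[s fE] : perm_eq (values f) t by rewrite perm_sym perm_sort.
have fsE i : f i = tnth t (s i).
  by have := congr1 (fun r => tnth r i) (val_inj fE); rewrite !tnth_mktuple.
exists [ffun i => tnth t i], s; split; last by apply/ffunP => i; rewrite !ffunE.
apply/decreasingP => i j lt_ij; rewrite !ffunE.
have t_sorted : sorted leI t by apply: sort_sorted.
have := sorted_ltn_nth leI_tr (tnth t i) t_sorted i j.
rewrite !inE !size_tuple !ltn_ord -!tnth_nth => /(_ isT isT lt_ij).
rewrite /leI leq_eqVlt => /predU1P[eq_t|//].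
have := fsE (s^-1 i)%g; have := fsE (s^-1 j)%g; rewrite !permKV.
rewrite (val_inj eq_t) => <- /f_inj/perm_inj e_ij.
by rewrite e_ij ltnn in lt_ij.
Qed.

Lemma det_mulmx_sum (R : comNzRingType) (A : 'M[R]_(n, N)) (B : 'M[R]_(N, n)) :
  \det (A *m B)
  = \sum_(f : idx) (\prod_i A i (f i)) * \det (\matrix_(i, j) B (f i) j).
Proof.
transitivity (\sum_(f : idx) \sum_(s : 'S_n)
    (-1) ^+ s * \prod_i (A i (f i) * B (f i) (s i))).
  rewrite exchange_big; apply: eq_bigr => /= s _.
  rewrite -big_distrr /= -(bigA_distr_bigA (fun i k => A i k * B k (s i))).
  by congr (_ * _); apply: eq_bigr => i _; rewrite mxE.
apply: eq_bigr => f _; rewrite big_distrr /=; apply: eq_bigr => s _.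
rewrite big_split /= mulrCA; congr (_ * (_ * _)).
by apply: eq_bigr => i _; rewrite mxE.
Qed.

(** In [det_mulmx_sum] a noninjective [f] repeats a row of [B]. An injective one is uniquely a
    decreasing [g] after a permutation [s], and the sum over [s] rebuilds the minor of [A]. *)
Lemma cauchy_binet (R : comNzRingType) (A : 'M[R]_(n, N)) (B : 'M[R]_(N, n)) :
  \det (A *m B)
  = \sum_(g : idx | decreasing g)
      \det (\matrix_(i, j) A i (g j)) * \det (\matrix_(i, j) B (g i) j).
Proof.
rewrite det_mulmx_sum (bigID (fun f : idx => injectiveb f)) /= addrC big1 ?add0r; last first.
  move=> f /injectivePn[i [j neq_ij eqf]].
  rewrite (determinant_alternate neq_ij) ?mulr0 // => k.
  by rewrite !mxE eqf.
pose D := [set x : idx * 'S_n | decreasing x.1].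
pose comp (x : idx * 'S_n) : idx := [ffun i => x.1 (x.2 i)].
rewrite (eq_bigl (fun f => f \in comp @: D)); last first.
  move=> f; apply/injectiveP/imsetP => [/inj_decreasing_perm[g [s [dg ->]]]|[[g s]]].
    by exists (g, s); rewrite ?inE.
  rewrite inE /= => dg -> i j; rewrite !ffunE /= => /(decreasing_inj dg).
  exact: perm_inj.
rewrite big_imset /=; last first.
  move=> [g s] [g' s']; rewrite !inE /= => dg dg' eqc.
  by have [/= -> ->] := decreasing_perm_inj dg dg' eqc.
rewrite (eq_bigl (fun x : idx * 'S_n => decreasing x.1 && true)) => [|x]; last first.
  by rewrite inE andbT.
rewrite -(pair_big decreasing xpredT (fun g s => (\prod_i A i (comp (g, s) i))
  * \det (\matrix_(i, j) B (comp (g, s) i) j))) /=.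
apply: eq_bigr => g _; rewrite mulr_suml; apply: eq_bigr => s _.
rewrite (_ : \matrix_(i, j) _ = row_perm s (\matrix_(i, j) B (g i) j)); last first.
  by apply/matrixP => i j; rewrite !mxE ffunE.
rewrite row_permE det_mulmx det_perm mulrCA mulrA; congr (_ * _ * _).
by apply: eq_bigr => i _; rewrite !mxE ffunE.
Qed.

End CauchyBinet.

(** * Division by the Vandermonde product *)

Section Newton.
Variables (R : comNzRingType) (x : nat -> R).

Definition newton (m : nat) : {poly R} := \prod_(l < m) ('X - (x l)%:P).

Lemma newton_expansion (m : nat) (p : {poly R}) :
  exists (d : nat -> R) (q : {poly R}),
    p = \sum_(k < m) d k *: newton k + q * newton m.
Proof.
elim: m p => [|m IHm] p.
  by exists (fun=> 0), p; rewrite big_ord0 add0r /newton big_ord0 mulr1.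
have [d [q ->]] := IHm p.
have /factor_theorem[r qE] : root (q - (q.[x m])%:P) (x m).
  by rewrite /root hornerD hornerN hornerC subrr.
exists (fun k => if k == m then q.[x m] else d k), r.
rewrite big_ord_recr /= eqxx -addrA; congr (_ + _).
  by apply: eq_bigr => k _; rewrite ltn_eqF.
rewrite -mul_polyC {3}/newton big_ord_recr /= -/(newton m).
by rewrite -{1}(subrK (q.[x m])%:P q) qE; ring.
Qed.

Lemma horner_newton m y : (newton m).[y] = \prod_(l < m) (y - x l).
Proof. by rewrite horner_prod; apply: eq_bigr => l _; rewrite hornerXsubC. Qed.

(** In the Newton basis at the points x_j the matrix factors through the values of that basis, a
    triangular matrix whose determinant is the Vandermonde product up to sign. *)
Lemma det_horner_dvd (n : nat) (p : nat -> {poly R}) :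
  exists q : R, q * (\prod_(i < n) \prod_(j < n | (i < j)%N) (x i - x j))
    = \det (\matrix_(i < n, j < n) (p i).[x j]).
Proof.
have [d dP] : exists d : nat -> nat -> R, forall i j, (j < n)%N ->
    (p i).[x j] = \sum_(k < n) d i k * (newton k).[x j].
  have ex i : exists d : nat -> R, forall j, (j < n)%N ->
      (p i).[x j] = \sum_(k < n) d k * (newton k).[x j].
    have [d [q ->]] := newton_expansion n (p i); exists d => j ltjn.
    (* The quotient term drops out because [newton n] vanishes at x_j for j < n. *)
    rewrite hornerD hornerM [(newton n).[_]]horner_newton.
    rewrite [\prod_(l < n) _](bigD1 (Ordinal ltjn)) //= subrr mul0r mulr0 addr0.
    by rewrite horner_sum; apply: eq_bigr => k _; rewrite hornerZ.
  exists (fun i => proj1_sig (constructive_indefinite_description _ (ex i))) => i j.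
  by case: (constructive_indefinite_description _ (ex i)) => /= d; apply.
pose D := \matrix_(i < n, k < n) d i k.
pose N := \matrix_(k < n, j < n) (newton k).[x j].
have -> : \matrix_(i < n, j < n) (p i).[x j] = D *m N.
  by apply/matrixP => i j; rewrite !mxE dP //; apply: eq_bigr => k _; rewrite !mxE.
have detN : \det N = \prod_(i < n) \prod_(j < n | (i < j)%N) (x j - x i).
  rewrite -det_tr det_trig; last first.
    apply/is_trig_mxP => j k ltjk; rewrite !mxE horner_newton.
    by rewrite (bigD1 (Ordinal ltjk)) //= subrr mul0r.
  rewrite (exchange_big_dep xpredT) //=; apply: eq_bigr => k _.
  rewrite !mxE horner_newton.
  by rewrite (big_ord_widen n (fun l => x k - x l)) // ltnW.
exists (\det D * \prod_(i < n) \prod_(j < n | (i < j)%N) -1).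
rewrite det_mulmx detN -mulrA -big_split /=; congr (_ * _).
apply: eq_bigr => i _; rewrite -big_split /=; apply: eq_bigr => j _.
by rewrite mulN1r opprB.
Qed.

End Newton.

(** * Regularity of the Vandermonde product and uniqueness of quotients *)

Section Regularity.

Lemma mcoeffMxvar (p : Zabx) i (m : {cmonom nat}) :
  (p * xvar i)@_m = \sum_(k <- msupp p) p@_k *+ (mmul k (ucm i) == m).
Proof.
rewrite (mcoeffMlw _ (fsubset_refl _) msuppU_le); apply: eq_bigr => k _.
by rewrite big_seq_fset1 mcoeffUU mulr1.
Qed.

Lemma mcoeffMxvarK (p : Zabx) i (m : {cmonom nat}) :
  (p * xvar i)@_(mmul m (ucm i)) = p@_m.
Proof.
rewrite mcoeffMxvar [in RHS](monalgE p) raddf_sum; apply: eq_bigr => k _.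
rewrite /= mcoeffU; congr (_ *+ nat_of_bool _).
apply/cmP/eqP => [eqm|-> //]; apply/eqP/cmP => l.
by have := eqm l; rewrite !cmM => /addIn.
Qed.

Lemma mcoeffMxvar0 (p : Zabx) i (m : {cmonom nat}) :
  m i = 0%N -> (p * xvar i)@_m = 0.
Proof.
move=> mi0; rewrite mcoeffMxvar; apply: big1 => k _.
by case: eqP => // em; move: mi0; rewrite -em cmM cmUU addn1.
Qed.

(** If p x_i = p x_j, the coefficient of p at m is 0 when x_j does not divide m, and otherwise
    equals the one at m x_i / x_j; induct on the exponent of x_j. *)
Lemma xvarB_rreg i j : i != j -> GRing.rreg (xvar i - xvar j).
Proof.
move=> neq_ij; apply: mulIr0_rreg => p /eqP.
rewrite mulrBr subr_eq0 => /eqP eqp.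
suff coef0 N (m : {cmonom nat}) : (m j < N)%N -> p@_m = 0.
  by apply/malgP => m; rewrite mcoeff0 (coef0 _ _ (ltnSn _)).
elim: N m => [|N IHN] m ltN; first by rewrite ltn0 in ltN.
rewrite -(mcoeffMxvarK p i) eqp.
have [m0|mj_gt0] := posnP (m j).
  by apply: mcoeffMxvar0; rewrite cmM cmU (negPf neq_ij) m0.
have [m' em] : exists m', m = mmul m' (ucm j).
  exists (divcm m (ucm j)); apply/eqP/cmP => k; rewrite cmM divcmE cmU.
  case: eqP => [<-|_]; first by rewrite subnK.
  by rewrite subn0 addn0.
have -> : mmul m (ucm i) = mmul (mmul m' (ucm i)) (ucm j).
  by rewrite em -!mulmA (mulmC (ucm j)).
rewrite mcoeffMxvarK; apply: IHN.
by move: ltN; rewrite em !cmM !cmU eqxx (negPf neq_ij); lia.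
Qed.

Lemma vandermonde_rreg n : GRing.rreg (vandermonde n).
Proof.
apply: big_ind => [|p q|i _]; [exact: rreg1|exact: rregM|].
apply: big_ind => [|p q|j lt_ij]; [exact: rreg1|exact: rregM|].
by apply: xvarB_rreg; rewrite eqSS neq_ltn lt_ij.
Qed.

(** Regularity makes the quotient unique, so the choice made by [epsilon] must be [r]. *)
Lemma exact_quo_vandermonde n (p r : Zabx) :
  r * vandermonde n = p -> exact_quo p (vandermonde n) = r.
Proof.
move=> rE; apply: (@vandermonde_rreg n); rewrite rE /exact_quo.
by apply: (epsilon_spec _ (fun r => r * vandermonde n = p)); exists r.
Qed.

Lemma schurM_vandermonde n mu :
  schur n mu * vandermonde n
  = \det (\matrix_(i < n, j < n) xvar j.+1 ^+ (part mu i + n - i.+1)).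
Proof.
have [q qE] := det_horner_dvd (fun j => xvar j.+1) n (fun i => 'X^(part mu i + n - i.+1)).
have qE' : q * vandermonde n
    = \det (\matrix_(i < n, j < n) xvar j.+1 ^+ (part mu i + n - i.+1)).
  by rewrite qE; congr (\det _); apply/matrixP => i j; rewrite !mxE hornerXn.
by rewrite /schur (exact_quo_vandermonde qE').
Qed.

End Regularity.

(** * Partitions in a box *)

Lemma intpart_eq (mu nu : intpart) : (forall i, part mu i = part nu i) -> mu = nu.
Proof.
move=> eqp; have eqs i : (i < size mu)%N = (i < size nu)%N.
  by rewrite -!part_gt0E eqp.
apply: val_inj; apply: (@eq_from_nth _ 0%N) => [|i _]; last exact: eqp.
case: (ltngtP (size mu) (size nu)) => // ltn; [have := eqs (size mu) | have := eqs (size nu)].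
  by rewrite ltn ltnn.
by rewrite ltn ltnn.
Qed.

(** In a weakly decreasing sequence the zeros form a tail, and 0 is also the default of [nth]. *)
Lemma nth_filter_gt0 (s : seq nat) i :
  sorted geq s -> nth 0%N [seq x <- s | (0 < x)%N] i = nth 0%N s i.
Proof.
have geq_tr : transitive geq by move=> x y z yx zy; apply: leq_trans zy yx.
elim: s i => // x s IHs i xs; have s_sorted := path_sorted xs.
rewrite [filter _ _]/=; case: ifPn => [_|]; first by case: i => //= i; apply: IHs.
rewrite -eqn0Ngt => /eqP x0.
have /all_pred1P -> : all (pred1 0%N) s.
  have := order_path_min geq_tr xs; rewrite x0; apply: sub_all => y /=.
  by rewrite leqn0.
by rewrite x0 filter_nseq nth_nil; case: i => //= i; rewrite nth_nseq if_same.
Qed.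

Section BoxedPartitions.
Variables (n M : nat).
Local Notation idx := {ffun 'I_n -> 'I_(M + n)}.
Implicit Type g : idx.

Lemma decreasing_gap g (i j : 'I_n) :
  decreasing g -> (i <= j)%N -> (g j + (j - i) <= g i)%N.
Proof.
move=> /decreasingP dg; have [d] := ubnP j; elim: d j => // d IHd j ltj.
rewrite leq_eqVlt => /predU1P[/val_inj ->|lt_ij]; first by rewrite subnn addn0.
have lt_j : (j.-1 < n)%N by have := ltn_ord j; lia.
have := IHd (Ordinal lt_j); have := dg (Ordinal lt_j) j; rewrite /=; lia.
Qed.

Lemma decreasing_ge g (i : 'I_n) : decreasing g -> (n - i.+1 <= g i)%N.
Proof.
move=> dg; have lt_n : (n.-1 < n)%N by have := ltn_ord i; lia.
by have := @decreasing_gap g i (Ordinal lt_n) dg; have := ltn_ord i; rewrite /=; lia.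
Qed.

Lemma decreasing_lt g (i : 'I_n) : decreasing g -> (g i <= M + (n - i.+1))%N.
Proof.
move=> dg; have lt_0 : (0 < n)%N by have := ltn_ord i; lia.
have := @decreasing_gap g (Ordinal lt_0) i dg; have := ltn_ord (g (Ordinal lt_0)).
by have := ltn_ord i; rewrite /=; lia.
Qed.

Definition staircase_diff g : seq nat := [seq (g i - (n - i.+1))%N | i <- enum 'I_n].

Lemma staircase_diff_sorted g : decreasing g -> sorted geq (staircase_diff g).
Proof.
move=> dg; rewrite /staircase_diff sorted_map.
apply: (@sub_sorted _ (relpre val ltn)) => [i j /= lt_ij|].
  have := decreasing_gap dg (ltnW lt_ij); have := decreasing_ge j dg.
  by have := ltn_ord j; lia.
by rewrite -sorted_map val_enum_ord iota_ltn_sorted.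
Qed.

Definition empty_part : intpart := @Partition [::] isT.

(** The partition mu with mu_i + n - i = g_i, its zeros dropped; the default [empty_part] is never
    resorted to for decreasing [g]. *)
Definition partition_of g : intpart :=
  insubd empty_part [seq x <- staircase_diff g | (0 < x)%N].

Lemma partition_ofE g : decreasing g ->
  parts (partition_of g) = [seq x <- staircase_diff g | (0 < x)%N].
Proof.
move=> dg; apply: insubdK; rewrite /is_partition unfold_in mem_filter ltnn andbT.
apply: sorted_filter (staircase_diff_sorted dg).
by move=> x y z yx zy; apply: leq_trans zy yx.
Qed.

Lemma size_partition_of g : decreasing g -> (size (partition_of g) <= n)%N.
Proof.
move=> dg; rewrite partition_ofE // size_filter.
by apply: leq_trans (count_size _ _) _; rewrite size_map size_enum_ord.
Qed.

Lemma part_partition_of g (i : 'I_n) : decreasing g ->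
  part (partition_of g) i = (g i - (n - i.+1))%N.
Proof.
move=> dg; rewrite /part partition_ofE // nth_filter_gt0 ?staircase_diff_sorted //.
by rewrite (nth_map i) ?size_enum_ord // nth_ord_enum.
Qed.

Lemma partition_ofK g (i : 'I_n) : decreasing g ->
  (part (partition_of g) i + n - i.+1)%N = g i.
Proof.
move=> dg; rewrite part_partition_of //.
by have := decreasing_ge i dg; have := ltn_ord i; lia.
Qed.

Lemma partition_of_inj g g' : decreasing g -> decreasing g' ->
  partition_of g = partition_of g' -> g = g'.
Proof.
move=> dg dg' eqp; apply/ffunP => i; apply: val_inj.
by rewrite /= -(partition_ofK i dg) -(partition_ofK i dg') eqp.
Qed.

Definition boxed_partitions : {fset intpart} :=
  seq_fset tt [seq partition_of g | g : idx <- index_enum _ & decreasing g].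

Lemma mem_boxed (mu : intpart) :
  (mu \in boxed_partitions) = (size mu <= n)%N && (head 0 mu <= M)%N.
Proof.
rewrite seq_fsetE; apply/mapP/andP => [[g]|[le_n le_M]].
  rewrite mem_filter => /andP[dg _ ->]; split; first exact: size_partition_of.
  have [n0|n_gt0] := posnP n.
    have := size_partition_of dg; rewrite n0 leqn0 => /eqP/size0nil ->.
    exact: leq0n.
  rewrite -nth0 -/(part _ _) -[0%N]/(nat_of_ord (Ordinal n_gt0)) part_partition_of //.
  by have := decreasing_lt (Ordinal n_gt0) dg; lia.
have lt_g (i : 'I_n) : (part mu i + n - i.+1 < M + n)%N.
  by have := part_head mu i; have := ltn_ord i; lia.
pose g : idx := [ffun i => Ordinal (lt_g i)].
have dg : decreasing g.
  apply/decreasingP => i j lt_ij; rewrite !ffunE /=.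
  by have := part_noninc mu (ltnW lt_ij); have := ltn_ord j; lia.
exists g; first by rewrite mem_filter dg mem_index_enum.
apply: intpart_eq => i; have [lti|gei] := ltnP i n; last first.
  by rewrite /part !nth_default // ?(leq_trans _ gei) ?size_partition_of.
rewrite -[i]/(nat_of_ord (Ordinal lti)) part_partition_of // ffunE /=; lia.
Qed.

Lemma sum_boxed (V : nmodType) (f : intpart -> V) :
  \sum_(mu <- boxed_partitions) f mu = \sum_(g : idx | decreasing g) f (partition_of g).
Proof.
pose s := [seq partition_of g | g : idx <- index_enum _ & decreasing g].
rewrite (perm_big s); first by rewrite big_map big_filter.
apply: uniq_perm; first exact: (fset_uniq boxed_partitions).
  rewrite map_inj_in_uniq ?filter_uniq ?index_enum_uniq // => g g'.
  by rewrite !mem_filter => /andP[dg _] /andP[dg' _]; apply: partition_of_inj.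
by move=> mu; rewrite seq_fsetE.
Qed.

End BoxedPartitions.

(** Expanding h_m[x_j + Z_i] in powers of x_j writes the matrix as a product; in the Cauchy-Binet
    formula the minors of [A] are the coefficients c and those of [B] the alternants. *)
Lemma det_h_alternants (R S : comNzRingType) (f : {rmorphism R -> S})
    (x : nat -> S) (n : nat) (lam : intpart) (a b : nat -> R) :
  \det (\matrix_(i < n, j < n)
     h (part lam i + n - i.+1)%N%:Z
       (<< x j >> - psum (f \o a) (part lam i).-1 + psum (f \o b) i))
  = \sum_(mu <- boxed_partitions n (head 0%N lam))
      f (c_coef n lam mu a b)
      * \det (\matrix_(i < n, j < n) x j ^+ (part mu i + n - i.+1)).
Proof.
set M := head 0%N lam.
pose A : 'M[S]_(n, M + n) := \matrix_(i, k)
  f (h ((part lam i + n - i.+1)%N%:Z - k%:Z) (- psum a (part lam i).-1 + psum b i)).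
pose B : 'M[S]_(M + n, n) := \matrix_(k, j) x j ^+ k.
rewrite sum_boxed (_ : \matrix_(i, j) _ = A *m B).
  rewrite cauchy_binet; apply: eq_bigr => g dg.
  rewrite /c_coef -det_map_mx.
  congr (_ * _); congr (\det _); apply/matrixP => i j; rewrite !mxE ?partition_ofK //.
  congr (f (h _ _)); rewrite -(partition_ofK j dg).
  by have := ltn_ord i; have := ltn_ord j; lia.
apply/matrixP => i j; rewrite !mxE -addrA addrC hD1_sum.
(* The degrees lambda_i + n - i stay below M + n; the added terms have [h] in negative degree. *)
rewrite (big_ord_widen (M + n) (fun k => x j ^+ k * h (_ - k%:Z) _)); last first.
  by have := part_head lam i; have := ltn_ord i; rewrite -/M; lia.
rewrite big_mkcond /=; apply: eq_bigr => k _.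
rewrite !mxE mulrC rmorph_h_psum; case: ifPn => // lt_k.
rewrite h_neg ?mul0r //; lia.
Qed.

(** * The Schur expansion *)

Lemma boxed_of_sub (lam mu : intpart) :
  part_sub mu lam -> mu \in boxed_partitions (size lam) (head 0%N lam).
Proof.
move=> sub_mu; rewrite mem_boxed -!nth0; apply/andP; split; last exact: (sub_mu 0%N).
rewrite leqNgt; apply/negP; rewrite -part_gt0E => mu_gt0.
by have := leq_trans mu_gt0 (sub_mu _); rewrite part_gt0E ltnn.
Qed.

(** For mu inside lam both determinants equal the tableau sum, in which n does not occur; otherwise
    both sides vanish. *)
Lemma c_coef_stable (n : nat) (lam mu : intpart) (a b : nat -> Zab) :
  (size lam <= n)%N -> (size mu <= n)%N ->
  c_coef n lam mu a b
  = if mu \in boxed_partitions (size lam) (head 0%N lam)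
    then c_coef (size lam) lam mu a b else 0.
Proof.
move=> lam_n mu_n; case: (classic (part_sub mu lam)) => [sub_mu|not_sub].
  by rewrite boxed_of_sub // !c_coef_ET_Z.
rewrite c_coef_not_sub //; case: ifPn => // mu_box.
by move: mu_box; rewrite mem_boxed => /andP[mu_lam _]; rewrite c_coef_not_sub.
Qed.

Lemma g_funE (n : nat) (lam : intpart) (a b : nat -> Zab) :
  g_fun lam a b n
  = \sum_(mu <- boxed_partitions n (head 0%N lam))
      (c_coef n lam mu a b)%:MP * schur n mu.
Proof.
apply: exact_quo_vandermonde; rewrite mulr_suml.
have := det_h_alternants (@malgC {cmonom nat} Zab) (fun j => xvar j.+1) n lam a b.
move=> detE; apply: etrans (esym detE).
by apply: eq_bigr => mu _; rewrite -mulrA schurM_vandermonde.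
Qed.

Definition schur_coefs (lam : intpart) (a b : nat -> Zab) : {malg Zab[intpart]} :=
  [malg mu in boxed_partitions (size lam) (head 0%N lam) => c_coef (size lam) lam mu a b].

(** One finite family must serve all n: the coefficients at n = [size lam] persist by
    [c_coef_stable]. *)
Lemma schur_expansion_g (lam : intpart) (a b : nat -> Zab) :
  schur_expansion (size lam) (g_fun lam a b) (schur_coefs lam a b).
Proof.
move=> n lam_n; rewrite g_funE; set d := schur_coefs lam a b.
pose boxn := boxed_partitions n (head 0%N lam).
have dE mu : mu \in boxn -> c_coef n lam mu a b = d@_mu.
  by rewrite mem_boxed => /andP[mu_n _]; rewrite c_coef_stable // mcoeffE.
have sub_d : (msupp d `<=` boxn)%fset.
  apply/fsubsetP => mu; rewrite -mcoeff_neq0 mcoeffE; case: ifPn => [|_]; last by rewrite eqxx.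
  by rewrite !mem_boxed => /andP[le_n ->] _; rewrite (leq_trans le_n).
rewrite (eq_big_seq (fun mu => (d@_mu)%:MP * schur n mu)) => [|mu /dE -> //].
rewrite -(big_fset_incl _ sub_d) /= => [|mu _ mu_d]; last first.
  by rewrite mcoeff_outdom // malgC0E mul0r.
rewrite big_seq [RHS]big_seq_cond; apply: eq_bigl => mu.
case: (boolP (mu \in msupp d)) => //= /(fsubsetP sub_d).
by rewrite mem_boxed => /andP[->].
Qed.

Lemma nonneg_coefsU (k : {cmonom param}) : nonneg_coefs << k >>.
Proof. by move=> m; rewrite mcoeffU mulrn_wge0. Qed.

Lemma nonneg_coefs0 : nonneg_coefs 0.
Proof. by move=> m; rewrite mcoeff0. Qed.

Lemma nonneg_coefsD p q : nonneg_coefs p -> nonneg_coefs q -> nonneg_coefs (p + q).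
Proof. by move=> p0 q0 m; rewrite mcoeffD addr_ge0. Qed.

Lemma nonneg_coefsM p q : nonneg_coefs p -> nonneg_coefs q -> nonneg_coefs (p * q).
Proof.
move=> p0 q0 m; rewrite mcoeffMl; apply: sumr_ge0 => k _; apply: sumr_ge0 => l _.
by rewrite mulrn_wge0 // mulr_ge0.
Qed.

(** After the sign change every factor is a sum of two terms, each a parameter or 0. *)
Lemma nonneg_ET_weights (lam mu : intpart) :
  nonneg_coefs (\sum_(T <- ET_Z lam mu) ET_weight (fun i => - alpha i) beta T).
Proof.
apply: big_ind => [||T _]; [exact: nonneg_coefs0|exact: nonneg_coefsD|].
apply: big_ind => [||u _]; [exact: nonneg_coefsU|exact: nonneg_coefsM|].
apply: nonneg_coefsD; last first.
  by case: (T u) => [[|k]|k]; [exact: nonneg_coefs0|exact: nonneg_coefsU|exact: nonneg_coefs0].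
case: (T u + _) => [[|k]|k] /=; rewrite ?oppr0 ?opprK;
  by [exact: nonneg_coefs0|exact: nonneg_coefsU].
Qed.

Theorem theorem4p4 (lam mu : intpart) (sub_mu_lam : part_sub mu lam) :
  (forall n : nat, (maxn (size lam) (size mu) <= n)%N ->
     c_coef n lam mu alpha beta
     = \sum_(T <- ET_Z lam mu) ET_weight alpha beta T)
  /\ schur_positive (size lam) (g_fun lam (fun i => - alpha i) beta)
  /\ (forall n : nat, (maxn (size lam) (size mu) <= n)%N ->
        nonneg_coefs (c_coef n lam mu (fun i => - alpha i) beta)).
Proof.
split=> [n|]; first by rewrite geq_max => /andP[lam_n _]; apply: c_coef_ET_Z.
split=> [|n]; last first.
  by rewrite geq_max => /andP[lam_n _]; rewrite c_coef_ET_Z //; apply: nonneg_ET_weights.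
exists (schur_coefs lam (fun i => - alpha i) beta); split; first exact: schur_expansion_g.
move=> nu; rewrite mcoeffE; case: ifPn => [|_]; last exact: nonneg_coefs0.
rewrite mem_boxed => /andP[nu_lam _].
case: (classic (part_sub nu lam)) => [sub_nu|not_sub].
  by rewrite c_coef_ET_Z //; apply: nonneg_ET_weights.
by rewrite c_coef_not_sub //; apply: nonneg_coefs0.
Qed.
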